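(* Let $K$ be a field of characteristic zero, $R=K[x,y,z]$ with the standard grading, and let $a,b,c,\beta,\gamma$ be integers with $a\geq c\geq 2$, $1\leq \beta\leq b-1$ and $\max\{1,b-a+1\}\leq \gamma\leq \min\{b-1,c-1\}$. Consider the ideal $$I=(x^a,\ y^b-x^{b-\gamma}z^\gamma,\ z^c,\ x^{a-b+\gamma}y^{b-\beta},\ y^{b-\beta}z^{c-\gamma})\subset R.$$ If $\max\{1,b+c-a-1\}\leq \beta\leq b-1$ and $\gamma\geq \left\lfloor\frac{\beta-a+b+c-2}{2}\right\rfloor$, then $R/I$ has the weak Lefschetz property.
   Context: A graded Artinian $K$-algebra $A=\bigoplus_i [A]_i$ has the weak Lefschetz property (WLP) if there exists a linear form $L\in[A]_1$ such that the multiplication map $\times L:[A]_i\to[A]_{i+1}$ has maximal rank (i.e. is injective or surjective) for every $i$. *)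

(* Defs.v *)
From mathcomp Require Import all_boot all_order all_algebra.
From mathcomp Require Export mpoly.
Set Implicit Arguments. Unset Strict Implicit. Unset Printing Implicit Defensive.
Import GRing.Theory.
Local Open Scope ring_scope.

Notation poly3 K := {mpoly K[3]}.

Definition vx {K : ringType} : poly3 K := 'X_(@Ordinal 3 0 erefl).
Definition vy {K : ringType} : poly3 K := 'X_(@Ordinal 3 1 erefl).
Definition vz {K : ringType} : poly3 K := 'X_(@Ordinal 3 2 erefl).

Definition in_ideal {K : comRingType} (gens : seq (poly3 K)) (f : poly3 K) : Prop :=
  exists r : 'I_(size gens) -> poly3 K, f = \sum_(j < size gens) r j * gens`_j.

(* For a homogeneous ideal I, [R/I]_i = R_i / (I \cap R_i).  The map
   x L : [R/I]_i -> [R/I]_(i+1), [f] |-> [L f], is injective iff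
   (f in R_i, L f in I => f in I), and surjective iff every g in R_(i+1)
   is congruent mod I to L f for some f in R_i. *)
Definition mult_injective {K : comRingType} (I : poly3 K -> Prop) (L : poly3 K) (i : nat) :=
  forall f : poly3 K, f \is i.-homog -> I (L * f) -> I f.

Definition mult_surjective {K : comRingType} (I : poly3 K -> Prop) (L : poly3 K) (i : nat) :=
  forall g : poly3 K, g \is i.+1.-homog ->
    exists2 f : poly3 K, f \is i.-homog & I (g - L * f).

(* Weak Lefschetz property of R/I: some linear form L (an element of [R/I]_1,
   represented by a homogeneous degree-1 polynomial) such that x L has
   maximal rank in every degree. *)
Definition has_WLP {K : comRingType} (I : poly3 K -> Prop) : Prop :=
  exists2 L : poly3 K, L \is 1.-homog &
    forall i : nat, mult_injective I L i \/ mult_surjective I L i.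

(* Main.v *)
(* With M = a - b + gamma, the ideal I = (x^a, y^b - x^(b-gamma) z^gamma, z^c) : y^beta
   is the annihilator of the functional [soc], so R/I is Gorenstein with socle degree
   s = a + b + c - 3 - beta.  By duality it suffices to find L such that x L is onto in all
   degrees d with 2 (d + 1) > s.  Take L = x - y - z and work in K[y,z] with x = y + z,
   in degree D = d + 1, with u_k = y^(D-k) z^k.  Then u_k = 0 for k >= c - gamma, and u_k is a
   nonnegative integer combination of u_(k+gamma), ..., u_(k+b) when k + b <= D.  If
   D > b + c - 2 - gamma this kills every u_k; if D = b + c - 2 - gamma, only the multiples
   of u_(c-gamma-1) survive, and all u_k are nonnegative integer multiples of it.  In that case
   x^M y^(b-beta), or its product with y, has degree D and expands to a positive integer
   multiple of u_(c-gamma-1), which therefore vanishes in characteristic zero. *)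

Require Import Defs.
From HB Require Import structures.
From mathcomp Require Import all_boot all_order all_algebra.
From mathcomp Require Import mpoly.
From mathcomp Require Import zify ring.
Import GRing.Theory Num.Theory.
Local Open Scope ring_scope.

(** * Closure properties of ideal membership *)

Section IdealMembership.
Context {K : comNzRingType} {gens : seq (poly3 K)}.

Lemma in_ideal0 : in_ideal gens 0.
Proof. by exists (fun=> 0); rewrite big1 // => j _; rewrite mul0r. Qed.

Lemma in_idealD f g : in_ideal gens f -> in_ideal gens g -> in_ideal gens (f + g).
Proof.
move=> [r ->] [s ->]; exists (fun j => r j + s j).
by rewrite -big_split; apply: eq_bigr => j _; rewrite mulrDl.
Qed.

Lemma in_idealMl g f : in_ideal gens f -> in_ideal gens (g * f).
Proof.
move=> [r ->]; exists (fun j => g * r j).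
by rewrite mulr_sumr; apply: eq_bigr => j _; rewrite mulrA.
Qed.

Lemma in_idealZ k f : in_ideal gens f -> in_ideal gens (k *: f).
Proof. by rewrite -mul_mpolyC; apply: in_idealMl. Qed.

Lemma in_ideal_gen j : (j < size gens)%N -> in_ideal gens gens`_j.
Proof.
move=> hj; exists (fun i => (i == Ordinal hj)%:R).
rewrite (bigD1 (Ordinal hj)) //= eqxx mul1r big1 ?addr0 // => i /negbTE ->.
by rewrite mul0r.
Qed.

End IdealMembership.

(** * Monomials in three variables and induction over them *)

Section Monomials.
Context {K : fieldType}.
Implicit Types (i j k : nat) (m : 'X_{1..3}).

Definition mono i j k : poly3 K := vx ^+ i * vy ^+ j * vz ^+ k.

Definition mnm3 i j k : 'X_{1..3} :=
  (U_(@Ordinal 3 0 erefl) *+ i + U_(@Ordinal 3 1 erefl) *+ j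
    + U_(@Ordinal 3 2 erefl) *+ k)%MM.

Lemma monoE i j k : mono i j k = 'X_[mnm3 i j k].
Proof. by rewrite /mono /vx /vy /vz !mpolyXD !mpolyXn. Qed.

Lemma mnm3K m :
  m = mnm3 (m (@Ordinal 3 0 erefl)) (m (@Ordinal 3 1 erefl)) (m (@Ordinal 3 2 erefl)).
Proof.
apply/mnmP => u; rewrite /mnm3 !mnmDE !mulmnE !mnm1E.
case: u => [[|[|[|//]]] hu]; rewrite /eq_op /= ?muln0 ?muln1 ?addn0 ?add0n;
  by rewrite ?mul0n ?mul1n ?addn0 ?add0n; congr (m _); apply: val_inj.
Qed.

Lemma mnm3E i j k :
  (mnm3 i j k (@Ordinal 3 0 erefl) = i)
  * (mnm3 i j k (@Ordinal 3 1 erefl) = j)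
  * (mnm3 i j k (@Ordinal 3 2 erefl) = k).
Proof.
by rewrite /mnm3 !mnmDE !mulmnE !mnm1E /eq_op /= !mul0n !mul1n !addn0.
Qed.

Lemma mdeg_mnm3 i j k : mdeg (mnm3 i j k) = (i + j + k)%N.
Proof. by rewrite /mnm3 !mdegD !mdegMn !mdeg1 !mul1n. Qed.

Lemma monoM i j k i' j' k' :
  mono i j k * mono i' j' k' = mono (i + i') (j + j') (k + k').
Proof. by rewrite /mono !exprD; ring. Qed.

Lemma mono_homog i j k : mono i j k \is (i + j + k)%N.-homog.
Proof. by rewrite monoE dhomogX; apply/eqP/mdeg_mnm3. Qed.

Lemma poly3_ind (P : poly3 K -> Prop) :
  P 0 -> (forall f g, P f -> P g -> P (f + g)) -> (forall l f, P f -> P (l *: f)) ->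
  (forall i j k, P (mono i j k)) -> forall f, P f.
Proof.
move=> P0 PD PZ Pm f; rewrite (mpolyE f); apply: (big_ind P) => // m _.
by apply: PZ; rewrite (mnm3K m) -monoE.
Qed.

Lemma homog3_ind d (P : poly3 K -> Prop) :
  P 0 -> (forall f g, P f -> P g -> P (f + g)) -> (forall l f, P f -> P (l *: f)) ->
  (forall i j k, (i + j + k)%N = d -> P (mono i j k)) ->
  forall f, f \is d.-homog -> P f.
Proof.
move=> P0 PD PZ Pm f /dhomogP hf; rewrite (mpolyE f) big_seq.
apply: (big_ind P) => // m /hf; rewrite (mnm3K m) => hm.
by apply: PZ; rewrite -monoE; apply: Pm; rewrite -mdeg_mnm3.
Qed.

End Monomials.

(** * Memberships and congruences given by the five generators *)

Section Gorenstein.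
Context {K : fieldType}.
Variables a b c beta gamma : nat.
Hypotheses (hbeta : (0 < beta < b)%N) (hgamma : (0 < gamma < b)%N).
Hypotheses (hgammac : (gamma < c)%N) (hgammaa : (b < a + gamma)%N).

Let gens : seq (poly3 K) :=
  [:: vx ^+ a;
      vy ^+ b - vx ^+ (b - gamma) * vz ^+ gamma;
      vz ^+ c;
      vx ^+ (a + gamma - b) * vy ^+ (b - beta);
      vy ^+ (b - beta) * vz ^+ (c - gamma)].
Let I := in_ideal gens.

Lemma gens_x i j k : (a <= i)%N -> I (mono i j k).
Proof.
move=> h; have -> : mono i j k = mono (i - a) j k * gens`_0.
  by rewrite [gens`_0](_ : _ = mono a 0 0) ?monoM ?addn0 ?subnK // /mono !expr0 !mulr1.
exact/in_idealMl/in_ideal_gen.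
Qed.

Lemma gens_z i j k : (c <= k)%N -> I (mono i j k).
Proof.
move=> h; have -> : mono i j k = mono i j (k - c) * gens`_2.
  by rewrite [gens`_2](_ : _ = mono 0 0 c) ?monoM ?addn0 ?subnK // /mono !expr0 !mul1r.
exact/in_idealMl/in_ideal_gen.
Qed.

Lemma gens_xy i j k : (a + gamma - b <= i)%N -> (b - beta <= j)%N -> I (mono i j k).
Proof.
move=> h h'; have -> : mono i j k =
    mono (i - (a + gamma - b)) (j - (b - beta)) k * gens`_3.
  rewrite [gens`_3](_ : _ = mono (a + gamma - b) (b - beta) 0).
    by rewrite monoM ?addn0 !subnK.
  by rewrite /mono expr0 mulr1.
exact/in_idealMl/in_ideal_gen.
Qed.

Lemma gens_yz i j k : (b - beta <= j)%N -> (c - gamma <= k)%N -> I (mono i j k).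
Proof.
move=> h h'; have -> : mono i j k = mono i (j - (b - beta)) (k - (c - gamma)) * gens`_4.
  rewrite [gens`_4](_ : _ = mono 0 (b - beta) (c - gamma)).
    by rewrite monoM ?addn0 !subnK.
  by rewrite /mono expr0 mul1r.
exact/in_idealMl/in_ideal_gen.
Qed.

Lemma gens_y i j k :
  I (mono i (j + b) k - mono (i + (b - gamma)) j (k + gamma)).
Proof.
have -> : mono i (j + b) k - mono (i + (b - gamma)) j (k + gamma) = mono i j k * gens`_1.
  rewrite [gens`_1](_ : _ = mono 0 b 0 - mono (b - gamma) 0 gamma).
    by rewrite mulrBr !monoM !addn0.
  by rewrite /mono !expr0 !mulr1 mul1r.
exact/in_idealMl/in_ideal_gen.
Qed.

(** * The socle functional *)

Let socdeg := (a + b + c - 3 - beta)%N.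

(* Modulo y^b = x^(b-gamma) z^gamma, these are the monomials whose product with y^beta reduces
   to the socle generator x^(a-1) y^(b-1) z^(c-1) of the complete intersection. *)
Definition soc_exp i j k : bool :=
  [exists t : 'I_c, [&& j == b - 1 - beta + t * b, i + t * (b - gamma) == a - 1
                      & k + t * gamma == c - 1]]%N.

Lemma soc_expP i j k :
  reflect (exists t, [/\ j = b - 1 - beta + t * b, i + t * (b - gamma) = a - 1
                      & k + t * gamma = c - 1])%N (soc_exp i j k).
Proof.
apply: (iffP existsP) => [[t /and3P[/eqP h1 /eqP h2 /eqP h3]]|[t [h1 h2 h3]]].
  by exists t.
(* Since [gamma > 0], [t <= t * gamma <= c - 1]: the bound in [soc_exp] loses no witness. *)
have ht : (t < c)%N by nia.
by exists (Ordinal ht); apply/and3P; split; apply/eqP.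
Qed.

Lemma soc_exp_deg i j k : soc_exp i j k -> (i + j + k)%N = socdeg.
Proof.
move=> /soc_expP[t [h1 h2 h3]]; rewrite /socdeg.
have : (t * (b - gamma) + t * gamma = t * b)%N by rewrite -mulnDr subnK //; lia.
lia.
Qed.

Definition soc_mnm (m : 'X_{1..3}) :=
  soc_exp (m (@Ordinal 3 0 erefl)) (m (@Ordinal 3 1 erefl)) (m (@Ordinal 3 2 erefl)).

(** The degree bound only makes the sum finite: by [soc_exp_deg] every exponent counted has degree
    exactly [socdeg]. *)
Definition soc (f : poly3 K) : K :=
  \sum_(m : 'X_{1..3 < socdeg.+1} | soc_mnm m) f@_m.

Lemma soc_is_scalar : scalar soc.
Proof.
move=> k f g; rewrite /soc mulr_sumr -big_split /=.
by apply: eq_bigr => m _; rewrite mcoeffD mcoeffZ.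
Qed.
HB.instance Definition _ := GRing.isLinear.Build K (poly3 K) K _ soc soc_is_scalar.

Lemma soc_mono i j k : soc (mono i j k) = (soc_exp i j k)%:R.
Proof.
rewrite /soc monoE; under eq_bigr do rewrite mcoeffX.
case: (boolP (soc_exp i j k)) => [h|h]; last first.
  rewrite big1 // => m hm; case: eqP => // e.
  by move: hm; rewrite /soc_mnm -e !mnm3E (negbTE h).
have hd : (mdeg (mnm3 i j k) < socdeg.+1)%N by rewrite mdeg_mnm3 (soc_exp_deg _ _ _ h).
rewrite (bigD1 (BMultinom hd)) /= ?eqxx; last by rewrite /soc_mnm !mnm3E.
rewrite big1 ?addr0 // => m /andP[_ hm]; case: eqP => // e.
by move: hm; rewrite -val_eqE /= e eqxx.
Qed.

Lemma soc_homog d f : f \is d.-homog -> d <> socdeg -> soc f = 0.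
Proof.
move=> hf hd; apply: big1 => m hm; apply: (dhomog_nemf_coeff hf).
apply/eqP => e; apply: hd; rewrite -e (mnm3K m) [LHS]mdeg_mnm3.
exact: soc_exp_deg.
Qed.

(** Multiples of [x^a] and [z^c] overshoot an exponent. For the [y^b] relation, [t.+1] on one term
    matches [t] on the other. For the last two generators the [y]-exponent excludes [t = 0], and [x]
    or [z] overshoots when [t > 0]. *)
Lemma soc_ideal f : I f -> soc f = 0.
Proof.
move=> [r ->]; rewrite raddf_sum big1 // => u _ /=.
move: (r u); apply: poly3_ind => [|g h Hg Hh|l g Hg|i j k].
- by rewrite mul0r raddf0.
- by rewrite mulrDl raddfD /= Hg Hh addr0.
- by rewrite -scalerAl linearZ /= Hg mulr0.
have Z i' j' k' : ~~ soc_exp i' j' k' -> soc (mono i' j' k') = 0.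
  by rewrite soc_mono => /negbTE ->.
case: u => [[|[|[|[|[|//]]]]] hu] /=.
- rewrite (_ : vx ^+ a = mono a 0 0) ?monoM; last by rewrite /mono !expr0 !mulr1.
  by apply/Z/soc_expP => -[t []]; lia.
- rewrite (_ : _ - _ = mono 0 b 0 - mono (b - gamma) 0 gamma); last first.
    by rewrite /mono !expr0 !mulr1 mul1r.
  rewrite mulrBr !monoM raddfB /= !soc_mono !addn0.
  apply/eqP; rewrite subr_eq0; apply/eqP; congr (_%:R); congr nat_of_bool.
  apply/soc_expP/soc_expP => -[t [h1 h2 h3]].
    by case: t h1 h2 h3 => [|t] h1 h2 h3; [lia|exists t; split; lia].
  by exists t.+1; split; lia.
- rewrite (_ : vz ^+ c = mono 0 0 c) ?monoM; last by rewrite /mono !expr0 !mul1r.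
  by apply/Z/soc_expP => -[t []]; lia.
- rewrite (_ : _ * _ = mono (a + gamma - b) (b - beta) 0) ?monoM; last first.
    by rewrite /mono !expr0 !mulr1.
  apply/Z/soc_expP => -[[|t]] []; first lia.
  rewrite mulSn; lia.
- rewrite (_ : _ * _ = mono 0 (b - beta) (c - gamma)) ?monoM; last first.
    by rewrite /mono !expr0 !mul1r.
  apply/Z/soc_expP => -[[|t]] []; first lia.
  rewrite mulSn; lia.
Qed.

(** * Standard monomials, their dual basis, and duality *)

Let idx := ('I_a * 'I_b * 'I_c)%type.

Definition standard (s : idx) : bool :=
  [|| (s.1.2 < b - beta)%N | (s.1.1 < a + gamma - b)%N && (s.2 < c - gamma)%N].

Definition mono_idx (s : idx) : poly3 K := mono s.1.1 s.1.2 s.2.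

(** The complement of [s] in the [soc_exp] monomial with [t = 0] in the first case and [t = 1] in
    the second; for standard [s] all subtractions are exact. *)
Definition dual_idx (s : idx) : poly3 K :=
  if (s.1.2 < b - beta)%N
  then mono (a - 1 - s.1.1) (b - 1 - beta - s.1.2) (c - 1 - s.2)
  else mono (a + gamma - b - 1 - s.1.1) (b + b - 1 - beta - s.1.2) (c - 1 - gamma - s.2).

(** Both [y]-exponents are below [b], so the equation for [y], read modulo [b], makes them equal and
    fixes [t]; the other two equations then identify [s] and [s']. *)
Lemma soc_dual (s s' : idx) : standard s -> standard s' ->
  soc (mono_idx s * dual_idx s') = (s' == s)%:R.
Proof.
case: s s' => [[i j] k] [[i' j'] k']; rewrite /standard /mono_idx /dual_idx /= => hs hs'.
have hi := ltn_ord i; have hj := ltn_ord j; have hk := ltn_ord k.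
have hi' := ltn_ord i'; have hj' := ltn_ord j'; have hk' := ltn_ord k'.
have -> : ((i', j', k') == (i, j, k)) = [&& i' == i :> nat, j' == j :> nat & k' == k :> nat].
  by rewrite !xpair_eqE -!val_eqE -andbA.
case: ifP => hlt; rewrite monoM soc_mono; congr (_%:R); congr nat_of_bool;
  apply/soc_expP/and3P => [[[|[|t]]]|].
- by case=> h1 h2 h3; split; apply/eqP; lia.
- by case=> h1 _ _; clear - h1 hj hj' hlt hbeta; lia.
- by rewrite !mulSn => -[h1 _ _]; clear - h1 hj hj' hlt hbeta; lia.
- by case=> /eqP h1 /eqP h2 /eqP h3; exists 0%N; split; lia.
- by case=> h1 _ _; clear - h1 hj hj' hbeta; lia.
- move: hs'; rewrite hlt /= => /andP[hsi hsk].
  rewrite !mul1n => -[h1 h2 h3]; split; apply/eqP.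
  + by clear - h2 hsi hi' hgamma hgammaa; lia.
  + by clear - h1 hj hj' hbeta; lia.
  + by clear - h3 hsk hk' hgammac; lia.
- by rewrite !mulSn => -[h1 _ _]; clear - h1 hj hj' hlt hbeta; lia.
- case=> /eqP h1 /eqP h2 /eqP h3; exists 1%N; rewrite !mul1n.
  move: hs'; rewrite hlt /= => /andP[hsi hsk]; split.
  + by clear - h2 hj hj' hbeta; lia.
  + by clear - h1 hsi hi' hgamma hgammaa; lia.
  + by clear - h3 hsk hk' hgammac; lia.
Qed.

(** Projection onto the span of the standard monomials, with coordinates read off by the dual basis.
    It is linear and kills [I], so no confluence argument is needed. *)
Definition normal_form (f : poly3 K) : poly3 K :=
  \sum_(s : idx | standard s) soc (f * dual_idx s) *: mono_idx s.

Lemma normal_formD f g : normal_form (f + g) = normal_form f + normal_form g.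
Proof.
rewrite -big_split; apply: eq_bigr => s _.
by rewrite mulrDl raddfD /= scalerDl.
Qed.

Lemma normal_formZ l f : normal_form (l *: f) = l *: normal_form f.
Proof.
rewrite scaler_sumr; apply: eq_bigr => s _.
by rewrite -scalerAl linearZ /= scalerA.
Qed.

Lemma normal_form_ideal f : I f -> normal_form f = 0.
Proof.
move=> hf; apply: big1 => s _; rewrite soc_ideal ?scale0r // mulrC.
exact: in_idealMl.
Qed.

Lemma normal_form_mono i j k : I (mono i j k - normal_form (mono i j k)).
Proof.
have inI f : I f -> I (f - normal_form f).
  by move=> hf; rewrite (normal_form_ideal _ hf) subr0.
(* The [y^b] relation lowers the [y]-exponent by [b] while raising the other two. *)
elim/ltn_ind: j i k => j IH i k.
have [hi|hi] := leqP a i; first exact/inI/gens_x.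
have [hk|hk] := leqP c k; first exact/inI/gens_z.
have [hj|hj] := leqP b j.
  have hJ : (j - b < j)%N by lia.
  have hy := gens_y i (j - b) k; rewrite subnK // in hy.
  have := in_idealD _ _ (inI _ hy) (IH _ hJ (i + (b - gamma))%N (k + gamma)%N).
  set f := mono i j k; set g := mono _ _ _.
  rewrite -[- g]scaleN1r normal_formD normal_formZ !scaleN1r.
  by rewrite (_ : _ + _ + _ = f - normal_form f) //; ring.
pose s : idx := (Ordinal hi, Ordinal hj, Ordinal hk).
have [hs|] := boolP (standard s).
  rewrite (_ : normal_form _ = mono_idx s) ?subrr; first exact: in_ideal0.
  rewrite /normal_form (bigD1 s) //= big1 ?addr0.
    by rewrite -[mono i j k]/(mono_idx s) soc_dual // eqxx scale1r.
  move=> s' /andP[hs' /negbTE ns].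
  by rewrite -[mono i j k]/(mono_idx s) soc_dual // ns scale0r.
rewrite /standard /= negb_or -leqNgt negb_and -!leqNgt => /andP[hj' /orP[h|h]].
  exact/inI/gens_xy.
exact/inI/gens_yz.
Qed.

Lemma normal_formP f : I (f - normal_form f).
Proof.
move: f; apply: poly3_ind => [|f g hf hg|l f hf|i j k].
- by rewrite normal_form_ideal ?subrr; apply: in_ideal0.
- by rewrite normal_formD opprD addrACA; apply: in_idealD.
- by rewrite normal_formZ -scalerBr; apply: in_idealZ.
- exact: normal_form_mono.
Qed.

(** If [L * f] is in [I], then [soc] kills [f * L * h] for all [h]. Surjectivity in complementary
    degree writes each relevant dual monomial as [L * h] modulo [I], so every coordinate of
    [normal_form f] vanishes. *)
Lemma mult_injective_dual L d : L \is 1.-homog ->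
  (forall e, (socdeg <= d + e.+1)%N -> mult_surjective I L e) ->
  (d < socdeg)%N ->
  mult_injective I L d.
Proof.
move=> hL hsurj hd f hf hLf.
suff nf0 : normal_form f = 0 by rewrite -[f]subr0 -nf0; apply: normal_formP.
apply: big1 => s _; suff -> : soc (f * dual_idx s) = 0 by rewrite scale0r.
have [e he] : exists e, dual_idx s \is e.-homog.
  by rewrite /dual_idx; case: ifP => _; eexists; apply: mono_homog.
have [hde|] := eqVneq (d + e)%N socdeg; last by move/eqP; apply: soc_homog (dhomogM hf he).
(* Here [d < socdeg] excludes a dual monomial of degree 0, which could not be a multiple of [L]. *)
case: e => [|e] in he hde *; first lia.
have [|h hh hI] := hsurj e _ _ he; first by rewrite hde.
rewrite -[dual_idx s](subrK (L * h)) mulrDr raddfD /= !soc_ideal ?addr0 //.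
  by rewrite mulrCA mulrA mulrC; apply: in_idealMl.
exact: in_idealMl.
Qed.

(** * Surjectivity by computing with [x = y + z] *)

Definition lefschetz_form : poly3 K := vx - (vy + vz).

Lemma vx_homog : (vx : poly3 K) \is 1.-homog.
Proof. by rewrite /vx dhomogX; apply/eqP/mdeg1. Qed.

Lemma vyz_homog : (vy + vz : poly3 K) \is 1.-homog.
Proof. by rewrite /vy /vz rpredD // dhomogX; apply/eqP/mdeg1. Qed.

Lemma lefschetz_form_homog : lefschetz_form \is 1.-homog.
Proof. by rewrite rpredB ?vx_homog ?vyz_homog. Qed.

Section Surjectivity.
Variable d : nat.

(** Vanishing in the cokernel of multiplication by the form, the sense in which [x = y + z] holds
    below. *)
Definition onto (f : poly3 K) : Prop :=
  exists2 g, g \is d.-homog & I (f - lefschetz_form * g).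

Lemma onto_ideal f : I f -> onto f.
Proof. by exists 0; rewrite ?rpred0 // mulr0 subr0. Qed.

Lemma onto0 : onto 0.
Proof. exact/onto_ideal/in_ideal0. Qed.

Lemma ontoD f g : onto f -> onto g -> onto (f + g).
Proof.
move=> [f' hf hf'] [g' hg hg']; exists (f' + g'); first exact: rpredD.
by rewrite mulrDr opprD addrACA; apply: in_idealD.
Qed.

Lemma ontoZ l f : onto f -> onto (l *: f).
Proof.
move=> [g hg hg']; exists (l *: g); first exact: rpredZ.
by rewrite -scalerAr -scalerBr; apply: in_idealZ.
Qed.

Lemma ontoMn n f : onto f -> onto (f *+ n).
Proof. by rewrite -scaler_nat; apply: ontoZ. Qed.

Lemma ontoB f g : onto f -> onto g -> onto (f - g).
Proof. by move=> hf hg; apply: ontoD => //; rewrite -scaleN1r; apply: ontoZ. Qed.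

Lemma ontoM g : g \is d.-homog -> onto (lefschetz_form * g).
Proof. by exists g => //; rewrite subrr; apply: in_ideal0. Qed.

Lemma onto_congr f g : onto (f - g) -> onto g -> onto f.
Proof. by move=> h /(ontoD _ _ h); rewrite subrK. Qed.

(* Junk value when [k > d.+1], because of the truncated subtraction. *)
Definition yz k : poly3 K := mono 0 (d.+1 - k) k.

Lemma onto_expand n j k : (n + j + k)%N = d.+1 ->
  onto (mono n j k - \sum_(q < n.+1) yz (k + q) *+ 'C(n, q)).
Proof.
move=> hd.
have -> : \sum_(q < n.+1) yz (k + q) *+ 'C(n, q) = (vy + vz) ^+ n * mono 0 j k.
  rewrite exprDn mulr_suml; apply: eq_bigr => q _.
  rewrite mulrnAl; congr (_ *+ _); have hq := ltn_ord q.
  have -> : vy ^+ (n - q) * vz ^+ q = mono 0 (n - q) q :> poly3 K by rewrite /mono expr0 mul1r.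
  by rewrite monoM /yz; congr mono; lia.
have -> : mono n j k = vx ^+ n * mono 0 j k :> poly3 K.
  by rewrite /mono expr0 mul1r mulrA.
rewrite -mulrBl subrXX -mulrA -/lefschetz_form.
(* The cofactor of [x - (y + z)] in [x^n - (y + z)^n] has degree [n - 1], so [n = 0] is separate. *)
case: n hd => [|n] hd; first by rewrite big_ord0 mul0r mulr0; apply: onto0.
apply: ontoM.
have -> : d = (n + (0 + j + k))%N by lia.
apply: dhomogM (mono_homog _ _ _); apply: rpred_sum => q _.
have hq : (q <= n)%N by rewrite -ltnS.
have := dhomogM (dhomogMn (n - q) vx_homog) (dhomogMn q vyz_homog).
by rewrite !mul1n subnK.
Qed.

Hypotheses (hd : (b + c - 1 - beta <= d.+1)%N) (hd' : (b + c - 2 - gamma <= d.+1)%N).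

Let top := (c - gamma - 1)%N.

(** When [k < c], [hd] leaves a [y]-exponent of at least [b - beta], so the last generator
    applies. *)
Lemma onto_yz_high k : (top < k)%N -> (k <= d.+1)%N -> onto (yz k).
Proof.
rewrite /top => h h'; apply: onto_ideal; rewrite /yz.
have [hk|hk] := leqP c k; first exact: gens_z.
by apply: gens_yz; lia.
Qed.

(** Replace [y^b] by [x^(b-gamma) z^gamma], then expand the power of [x]. *)
Lemma onto_yz_low k : (k + b <= d.+1)%N ->
  onto (yz k - \sum_(q < (b - gamma).+1) yz (k + gamma + q) *+ 'C(b - gamma, q)).
Proof.
move=> hk; rewrite /yz; set f := mono _ _ _.
have h := gens_y 0 (d.+1 - k - b) k; rewrite subnK in h; last lia.
have hx := @onto_expand (b - gamma) (d.+1 - k - b) (k + gamma).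
have := ontoD _ _ (onto_ideal _ h) (hx _).
by rewrite add0n addrA subrK; apply; lia.
Qed.

(** The multiplier is a natural number, not a scalar, so that multipliers cannot cancel when
    added. *)
Definition top_multiple (f : poly3 K) : Prop := exists n, onto (f - yz top *+ n).

Lemma top_multiple_onto f : onto f -> top_multiple f.
Proof. by exists 0%N; rewrite mulr0n subr0. Qed.

Lemma top_multiple_congr f g : onto (f - g) -> top_multiple g -> top_multiple f.
Proof. by move=> h [n /(ontoD _ _ h)]; rewrite addrA subrK; exists n. Qed.

Lemma top_multipleMn m f : top_multiple f -> top_multiple (f *+ m).
Proof. by move=> [n hn]; exists (n * m)%N; rewrite mulrnA -mulrnBl; apply: ontoMn. Qed.

Lemma top_multiple_sum (J : finType) (P : pred J) (F : J -> poly3 K) :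
  (forall q, P q -> top_multiple (F q)) -> top_multiple (\sum_(q | P q) F q).
Proof.
apply: big_ind => [|f g [n hn] [m hm]]; first exact/top_multiple_onto/onto0.
by exists (n + m)%N; rewrite mulrnDr opprD addrACA; apply: ontoD.
Qed.

Lemma yz_multiple k : (k <= d.+1)%N -> top_multiple (yz k).
Proof.
move: {2}(d.+1 - k)%N (leqnn (d.+1 - k)) => r.
elim: r k => [|r IH] k hr hk.
  by apply/top_multiple_onto/onto_yz_high; rewrite /top; lia.
have [hlt|hge] := ltnP top k; first exact/top_multiple_onto/onto_yz_high.
have [->|hne] := eqVneq k top.
  by exists 1%N; rewrite mulr1n subrr; apply: onto0.
(* From [k <= c - gamma - 2] and [hd']. The rewriting then only produces indices above [k], as
   [gamma > 0]. *)
have hkb : (k + b <= d.+1)%N by rewrite /top in hge hne; lia.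
apply: top_multiple_congr (onto_yz_low _ hkb) _.
by apply: top_multiple_sum => q _; apply/top_multipleMn/IH; have := ltn_ord q; lia.
Qed.

Hypothesis char0 : [pchar K] =i pred0.
Hypothesis hd_eq : d.+1 = (b + c - 2 - gamma)%N ->
  (a + gamma - beta <= d.+1 <= (a + gamma - beta).+1)%N.

Lemma onto_yz_top : onto (yz top).
Proof.
(* With strict inequality [top + b <= d.+1], so [yz top] itself rewrites to terms of index above
   [top]. *)
have [hlt|hge] := ltnP (b + c - 2 - gamma) d.+1.
  apply: onto_congr (onto_yz_low _ _) _; first by rewrite /top; lia.
  apply: (big_ind onto) => [||q _]; [exact: onto0|exact: ontoD|].
  by apply/ontoMn/onto_yz_high; have := ltn_ord q; rewrite /top; lia.
have hD : d.+1 = (b + c - 2 - gamma)%N by lia.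
have hM := hd_eq hD.
set M := (a + gamma - b)%N; set j := (d.+1 - M)%N.
have hj : (M + j + 0)%N = d.+1 by rewrite /j /M; lia.
(* Here [hd] and [hD] give [beta > gamma], hence [beta >= 2], and the upper bound in [hM] yields
   [top <= M]: the term [yz top] does occur in the expansion. *)
have htop : (top < M.+1)%N by rewrite /top /M; lia.
have : onto (mono M j 0) by apply/onto_ideal/gens_xy; rewrite // /j /M; lia.
move/ontoB => /(_ _ (onto_expand _ _ _ hj)); rewrite opprB addrC subrK.
under eq_bigr do rewrite add0n.
rewrite (bigD1 (Ordinal htop)) //=.
set S := \sum_(_ | _) _.
have [n hn] : top_multiple S.
  by apply: top_multiple_sum => q _; apply/top_multipleMn/yz_multiple; have := ltn_ord q; lia.
move=> hS; have := ontoB _ _ hS hn.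
rewrite opprB addrACA subrr addr0 -mulrnDr.
set N := (_ + _)%N => hN.
(* The summand ['C(M, top)] is positive and the other is a natural number. *)
have N0 : N%:R != 0 :> K.
  have /pcharf0P -> := char0.
  by rewrite /N -lt0n addn_gt0 bin_gt0 -[(top <= M)%N]/(top < M.+1)%N htop.
by have := ontoZ N%:R^-1 _ hN; rewrite -scaler_nat scalerA mulVf // scale1r.
Qed.

Lemma lefschetz_surjective : mult_surjective I lefschetz_form d.
Proof.
have hyz k : (k <= d.+1)%N -> onto (yz k).
  move=> /yz_multiple[n hn]; apply: onto_congr hn _.
  exact/ontoMn/onto_yz_top.
move=> g hg; move: g hg; apply: homog3_ind => [|f g hf hg|l f hf|i j k hijk].
- exact: onto0.
- exact: ontoD.
- exact: ontoZ.
apply: onto_congr (onto_expand _ _ _ hijk) _.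
apply: (big_ind onto) => [||q _]; [exact: onto0|exact: ontoD|].
by apply/ontoMn/hyz; have := ltn_ord q; lia.
Qed.

End Surjectivity.

End Gorenstein.

(** * Surjectivity above half the socle degree, injectivity below by duality *)

Theorem theorem3p4 (K : fieldType) (charK0 : [pchar K] =i pred0)
  (a b c beta gamma : nat)
  (hac : (c <= a)%N) (hc : (2 <= c)%N)
  (hbeta1 : (1 <= beta)%N) (hbeta2 : (beta <= b - 1)%N)
  (hgamma1 : (1 <= gamma)%N) (hgamma2 : (b%:Z - a%:Z + 1 <= gamma%:Z)%R)
  (hgamma3 : (gamma <= b - 1)%N) (hgamma4 : (gamma <= c - 1)%N)
  (hbeta3 : (b%:Z + c%:Z - a%:Z - 1 <= beta%:Z)%R)
  (hgamma5 : ((beta%:Z - a%:Z + b%:Z + c%:Z - 2) %/ 2 <= gamma%:Z)%Z) :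
  has_WLP (in_ideal
    [:: vx ^+ a;
        vy ^+ b - vx ^+ (b - gamma) * vz ^+ gamma;
        vz ^+ c;
        vx ^+ (a + gamma - b) * vy ^+ (b - beta);
        vy ^+ (b - beta) * vz ^+ (c - gamma) : {mpoly K[3]}]).
Proof.
have hb : (0 < beta < b)%N by lia.
have hg : (0 < gamma < b)%N by lia.
have hgc : (gamma < c)%N by lia.
have hga : (b < a + gamma)%N by lia.
have hsurj e : (a + b + c - 3 - beta < e.+1.*2)%N ->
    mult_surjective (in_ideal [:: vx ^+ a; vy ^+ b - vx ^+ (b - gamma) * vz ^+ gamma;
      vz ^+ c; vx ^+ (a + gamma - b) * vy ^+ (b - beta);
      vy ^+ (b - beta) * vz ^+ (c - gamma)]) (lefschetz_form (K := K)) e.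
  (* With [he], [hbeta3] gives [hd] and [hgamma5] gives [hd']. In [hd_eq] the lower bound comes from
     [he] and the upper one from [hgamma5], whose floor accounts for the extra 1. *)
  move=> he; apply: lefschetz_surjective => //; lia.
exists lefschetz_form; first exact: lefschetz_form_homog.
move=> d; have [hd|hd] := ltnP (a + b + c - 3 - beta) d.+1.*2.
  by right; apply: hsurj.
left; apply: mult_injective_dual => //; first exact: lefschetz_form_homog.
  (* If [2 (d + 1) <= s] and [s <= d + e + 1], then [2 (e + 1) >= s + 2], where [s] is the socle
     degree. *)
  by move=> e he; apply: hsurj; lia.
lia.
Qed.
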